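(* For each integer $n\ge 1$, $n\text{-SDPDA} \subsetneq (n+1)\text{-SDPDA}$. In addition, the witness languages are binary; that is, for each $n\ge 1$ there is a language over a two-letter input alphabet that belongs to $(n+1)\text{-SDPDA}$ but not to $n\text{-SDPDA}$.
   Context: Alphabets are finite nonempty sets; $\varepsilon$ denotes the empty string. A stateless deterministic pushdown automaton is $M=(\Sigma,\Gamma,\delta,\alpha)$, where $\Sigma$ is the input alphabet, $\Gamma$ is the pushdown alphabet, $\alpha\in\Gamma^+$ is the initial pushdown string, and $\delta$ maps $\Gamma\times(\Sigma\cup\{\varepsilon\})$ to finite subsets of $\Gamma^*$, subject to determinism: $|\delta(A,a)|\le 1$ for all $A\in\Gamma$, $a\in\Sigma\cup\{\varepsilon\}$, and if $\delta(A,\varepsilon)\neq\emptyset$ then $\delta(A,a)=\emptyset$ for all $a\in\Sigma$. Configurations are pairs $(\gamma,\sigma)\in\Gamma^*\times\Sigma^*$ (pushdown content with the top as the rightmost symbol, and unread input). The step relation is $(\gamma A,a\sigma)\vdash(\gamma w,\sigma)$ whenever $w\in\delta(A,a)$, with $A\in\Gamma$, $a\in\Sigma\cup\{\varepsilon\}$; $\vdash^*$ is its reflexive and transitive closure. The accepted language (by empty pushdown) is $L(M)=\{w\in\Sigma^*\mid(\alpha,w)\vdash^*(\varepsilon,\varepsilon)\}$. For $n\ge 1$, $n\text{-SDPDA}$ is the family of all languages accepted by a stateless deterministic pushdown automaton with $|\Gamma|\le n$. *)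

(* Defs.v *)
From Stdlib Require Import Relation_Operators.
From mathcomp Require Import all_boot.
From mathcomp Require Import finmap.

Set Implicit Arguments.
Unset Strict Implicit.
Unset Printing Implicit Defensive.

Local Open Scope fset_scope.

Definition language (Sigma : finType) := seq Sigma -> Prop.

(* In the second argument of the transition function, [Some a] is the input
   symbol a and [None] is the empty string.  Nonemptiness of the pushdown
   alphabet follows from that of the initial pushdown string. *)
Record sdpda (Sigma Gamma : finType) := Sdpda {
  delta : Gamma -> option Sigma -> {fset (seq Gamma)};
  initial : seq Gamma;
  input_nonempty : 0 < #|Sigma|;
  initial_nonempty : initial <> [::];
  delta_le1 : forall (A : Gamma) (a : option Sigma), #|` delta A a| <= 1;
  delta_eps : forall A : Gamma, delta A None <> fset0 ->
    forall a : Sigma, delta A (Some a) = fset0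
}.

Definition config (Sigma Gamma : finType) : Type := (seq Gamma * seq Sigma)%type.

Definition input_word (Sigma : finType) (a : option Sigma) : seq Sigma :=
  if a is Some b then [:: b] else [::].

(* The top of the pushdown is the last element of the sequence. *)
Inductive step (Sigma Gamma : finType) (M : sdpda Sigma Gamma) :
    config Sigma Gamma -> config Sigma Gamma -> Prop :=
  Step (gamma w : seq Gamma) (A : Gamma) (a : option Sigma) (sigma : seq Sigma) :
    w \in delta M A a ->
    step M (rcons gamma A, input_word a ++ sigma) (gamma ++ w, sigma).

Definition accepted (Sigma Gamma : finType) (M : sdpda Sigma Gamma) :
    language Sigma :=
  fun w => clos_refl_trans _ (step M) (initial M, w) ([::], [::]).

Definition language_family := forall Sigma : finType, language Sigma -> Prop.

Definition SDPDA (n : nat) : language_family := fun Sigma L =>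
  exists (Gamma : finType) (M : sdpda Sigma Gamma),
    #|Gamma| <= n /\ forall w : seq Sigma, L w <-> accepted M w.

Definition subfamily (F G : language_family) : Prop :=
  forall (Sigma : finType) (L : language Sigma), F Sigma L -> G Sigma L.

Definition proper_subfamily (F G : language_family) : Prop :=
  subfamily F G /\ ~ subfamily G F.

(* Main.v *)
(** The witness is [{a^j b : j <= n}], with [a = false] and [b = true].  The
    language of a pushdown string is the concatenation of the prefix-free
    languages of its symbols, so if it contains a one-letter word then all
    symbols but one accept only the empty word, and it is the language of a
    single symbol.  The residuals of the witness by [a^i], [0 <= i <= n], all
    contain [b] and are pairwise distinct, which forces [n + 1] symbols. *)
From Stdlib Require Import Operators_Properties Relation_Operators.
Require Import Defs.
From mathcomp Require Import all_boot.
From mathcomp Require Import finmap.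

Set Implicit Arguments.
Unset Strict Implicit.
Unset Printing Implicit Defensive.

Local Open Scope fset_scope.

(** * Runs of a stateless deterministic pushdown automaton *)

Section Runs.

Variables (Sigma Gamma : finType) (M : sdpda Sigma Gamma).

Implicit Types (c : config Sigma Gamma) (g : seq Gamma) (u v w : seq Sigma).

(** This form of the closure exposes the first step of a run, the one that determinism fixes. *)
Definition steps c c' := clos_refl_trans_1n _ (step M) c c'.

Definition accepts g w := steps (g, w) ([::], [::]).

Lemma acceptedE w : accepted M w <-> accepts (initial M) w.
Proof. by rewrite /accepts /steps -clos_rt_rt1n_iff. Qed.

Lemma steps_step c1 c2 c3 : step M c1 c2 -> steps c2 c3 -> steps c1 c3.
Proof. exact: rt1n_trans. Qed.

Lemma steps_trans c1 c2 c3 : steps c1 c2 -> steps c2 c3 -> steps c1 c3.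
Proof.
by move=> s12 s23; elim: s12 s23 => // x y z xy _ IH /IH; apply: steps_step.
Qed.

Lemma delta_functional A a x1 x2 :
  x1 \in delta M A a -> x2 \in delta M A a -> x1 = x2.
Proof.
move=> h1 h2; apply/eqP; have := delta_le1 M A a.
have /fsubset_leq_card : [fset x1; x2] `<=` delta M A a.
  by rewrite fsubUset !fsub1set h1 h2.
by rewrite cardfs2 => /leq_trans le /le; case: eqP.
Qed.

Lemma delta_eps_excl A a x1 x2 :
  x1 \in delta M A None -> x2 \in delta M A (Some a) -> False.
Proof.
move=> h1; rewrite delta_eps ?in_fset0 // => h0.
by rewrite h0 in_fset0 in h1.
Qed.

Lemma step_functional c c1 c2 : step M c c1 -> step M c c2 -> c1 = c2.
Proof.
case=> g1 w1 A a1 s1 h1 h; inversion h as [g2 w2 B a2 s2 h2 [eg es] ec2].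
have [eg' eB] := rcons_inj eg; subst g2 B; clear h.
case: a1 a2 h1 h2 es => [x|] [y|] h1 h2 /=.
- by case=> ? ->; subst y; rewrite (delta_functional h1 h2).
- by case: (delta_eps_excl h2 h1).
- by case: (delta_eps_excl h1 h2).
- by move=> ->; rewrite (delta_functional h1 h2).
Qed.

Lemma step_nil v c : ~ step M ([::], v) c.
Proof. by move=> h; inversion h as [[|? ?]]. Qed.

(** By determinism both runs from [c] take the same steps, and the accepting one cannot end first,
    since an empty pushdown allows no step. *)
Lemma steps_accepts c g w :
  steps c (g, w) -> steps c ([::], [::]) -> accepts g w.
Proof.
rewrite /accepts; move: (g, w) => c' s.
elim: s => // x y z xy _ IH h; apply: IH.
inversion h as [e|y' z' xy' s']; first by rewrite e in xy; case: (step_nil xy).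
by rewrite (step_functional xy xy').
Qed.

Lemma step_frame g g' w w' d v :
  step M (g, w) (g', w') -> step M (d ++ g, w ++ v) (d ++ g', w' ++ v).
Proof.
move=> h; inversion h as [g1 x A a s hx]; subst.
by rewrite -rcons_cat (catA d) -catA; constructor.
Qed.

Lemma steps_frame g g' w w' d v :
  steps (g, w) (g', w') -> steps (d ++ g, w ++ v) (d ++ g', w' ++ v).
Proof.
move e: (g, w) => c; move e': (g', w') => c' s.
elim: s g w e e' => [x|x [h y] z xy _ IH] g1 w1 e e'.
  by move: e; rewrite -e' => -[-> ->]; constructor.
by rewrite -e in xy; apply: steps_step (step_frame d v xy) (IH _ _ _ e').
Qed.

Lemma accepts_nil w : accepts [::] w -> w = [::].
Proof.
by move=> h; inversion h as [|? ? s]; subst => //; case: (step_nil s).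
Qed.

Lemma accepts_cat g1 g2 w1 w2 :
  accepts g1 w1 -> accepts g2 w2 -> accepts (g1 ++ g2) (w2 ++ w1).
Proof.
move=> h1 /(steps_frame g1 w1); rewrite cats0 => h2.
exact: steps_trans h2 h1.
Qed.

(** As long as the part above [g1] is nonempty, each step rewrites only that part; once it is empty,
    the rest of the run is a run of [g1]. The top is on the right, so [g2] reads its word first. *)
Lemma accepts_split g1 g2 w : accepts (g1 ++ g2) w ->
  exists w1 w2, [/\ w = w2 ++ w1, accepts g1 w1 & accepts g2 w2].
Proof.
rewrite /accepts; move e: (g1 ++ g2, w) => c; move e': ([::], [::]) => c' s.
elim: s g1 g2 w e e' => [x|x y z xy yz IH] g1 g2 w e e'.
  move: e; rewrite -e'; case: g1 g2 => [|//] [|//] [->].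
  by exists [::], [::]; split => //; constructor.
case/lastP: g2 e => [|g2 A] e.
  exists w, [::]; rewrite cats0 in e.
  split => //; last by rewrite -e'; constructor.
  by rewrite -e in xy; apply: steps_step xy yz.
rewrite -e -rcons_cat in xy.
inversion xy as [g x' B a s hx [eg es] ey].
have [? ?] := rcons_inj eg; subst g B.
have [|w1 [w2 [es' h1 h2]]] := IH g1 (g2 ++ x') s _ e'; first by rewrite catA.
exists w1, (input_word a ++ w2); rewrite es' catA; split => //.
by apply: steps_step h2; constructor.
Qed.

(** By determinism, the accepting run on [u ++ v] passes through the empty pushdown with [v] unread,
    where it is stuck. *)
Lemma accepts_prefix_free g u v :
  accepts g u -> accepts g (u ++ v) -> v = [::].
Proof.
move=> /(steps_frame [::] v) /steps_accepts h /h; exact: accepts_nil.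
Qed.

Lemma accepts_epsilon_only g w : accepts g [::] -> accepts g w -> w = [::].
Proof. exact: (@accepts_prefix_free g [::] w). Qed.

Lemma accepts_letter_symbol g x : accepts g [:: x] ->
  exists A, forall w, accepts [:: A] w <-> accepts g w.
Proof.
elim/last_ind: g => [/accepts_nil //|g A IH]; rewrite -cats1.
move=> /accepts_split [w1 [[|y w2] [/= e h1 h2]]].
  rewrite -e in h1; have [B hB] := IH h1; exists B => w; rewrite hB; split.
    by move=> h; apply: (accepts_cat h h2).
  case/accepts_split=> v1 [v2 [-> hv1 hv2]].
  by rewrite (accepts_epsilon_only h2 hv2).
(* Here [A] reads the letter, so everything below it accepts only the empty word. *)
have e1 : w1 = [::] by case: e => _; case: w2 {h2} => // <-.
rewrite e1 in h1; exists A => w; split.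
  by move=> h; rewrite -[w]cats0; apply: accepts_cat.
case/accepts_split=> v1 [v2 [-> hv1 hv2]].
by rewrite (accepts_epsilon_only h1 hv1) cats0.
Qed.

(** The accepting run is stopped once [u] has been read; its steps so far do not depend on the
    unread input, so they can be replayed before any [v']. *)
Lemma accepts_consume g u v : accepts g (u ++ v) ->
  exists g', forall v', steps (g, u ++ v') (g', v').
Proof.
rewrite /accepts; move e: (g, u ++ v) => c; move e': ([::], [::]) => c' s.
elim: s g u e e' => [x|x y z xy yz IH] g [|b u] e e'.
- by exists g; constructor.
- by move: e; rewrite -e'.
- by exists g; constructor.
rewrite -e in xy; inversion xy as [g1 x' A a s hx [eg es] ey].
case: a hx es xy => [a|] hx /= es _.
  case: es => ? es; subst a s.
  have [g' hg'] := IH _ _ ey e'; exists g' => v'.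
  apply: steps_step (hg' v').
  exact: (@Step _ _ M g1 x' A (Some b) (u ++ v')).
subst s.
have [g' hg'] := IH _ (b :: u) ey e'; exists g' => v'.
apply: steps_step (hg' v').
exact: (@Step _ _ M g1 x' A None (b :: u ++ v')).
Qed.

Lemma residual_symbol u x : accepted M (u ++ [:: x]) ->
  exists A, forall w, accepts [:: A] w <-> accepted M (u ++ w).
Proof.
move=> /acceptedE h; have [g hg] := accepts_consume h.
have [A hA] := accepts_letter_symbol (steps_accepts (hg _) h).
exists A => w; rewrite hA acceptedE; split; last exact: steps_accepts (hg w).
exact: steps_trans (hg w).
Qed.

End Runs.

(** * The witness language needs [n.+1] pushdown symbols *)

Definition witness (n : nat) : language bool :=
  fun w => exists2 j, j <= n & w = nseq j false ++ [:: true].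

Lemma witness_nseq n j : witness n (nseq j false ++ [:: true]) <-> j <= n.
Proof.
split; last by exists j.
by case=> i hi /(congr1 size); rewrite !size_cat !size_nseq => /addIn ->.
Qed.

Lemma witness_lower_bound n : ~ SDPDA n (witness n).
Proof.
case=> Gamma [M [card_Gamma hM]].
have symb (i : 'I_n.+1) :
    exists A, forall w, accepts M [:: A] w <-> witness n (nseq i false ++ w).
  have /hM/residual_symbol [A hA] : witness n (nseq i false ++ [:: true]).
    by apply/witness_nseq; rewrite -ltnS.
  by exists A => w; rewrite hA hM.
have [f hf] := fin_all_exists symb.
(* The residual by [i] letters [false] contains [n - i] further ones followed by [true]; if the
   residual by [j] does too, then [j + (n - i) <= n]. *)
have f_le i j : f i = f j -> j <= i.
  move=> e; have le_in : i <= n by rewrite -ltnS.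
  have : witness n (nseq i false ++ nseq (n - i) false ++ [:: true]).
    by rewrite catA -nseqD; apply/witness_nseq; rewrite subnKC.
  rewrite -hf e hf catA -nseqD => /witness_nseq.
  by rewrite -[X in _ <= X](subnKC le_in) leq_add2r.
have f_inj : injective f.
  by move=> i j e; apply/val_inj/eqP; rewrite eqn_leq !f_le.
have := leq_trans (leq_card f f_inj) card_Gamma.
by rewrite card_ord ltnn.
Qed.

(** * An automaton with [n.+1] symbols for the witness *)

Section WitnessAutomaton.

Variable n : nat.

(** The single pushdown symbol counts the letters [false] read so far. The test [i < n] ensures that
    [inord] never falls back on its default value. *)
Definition witness_delta (i : 'I_n.+1) (a : option bool) : {fset seq 'I_n.+1} :=
  match a with
  | None => fset0
  | Some true => [fset [::]]
  | Some false => if i < n then [fset [:: inord i.+1]] else fset0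
  end.

Lemma witness_delta_le1 i a : #|` witness_delta i a| <= 1.
Proof.
by case: a => [[]|] /=; try case: ifP; rewrite ?cardfs1 ?cardfs0.
Qed.

Lemma bool_nonempty : 0 < #|{: bool}|.
Proof. by rewrite card_bool. Qed.

Lemma witness_delta_eps i : witness_delta i None <> fset0 ->
  forall a, witness_delta i (Some a) = fset0.
Proof. by []. Qed.

Definition witness_sdpda : sdpda bool 'I_n.+1 :=
  @Sdpda _ _ witness_delta [:: ord0] bool_nonempty (fun e => ltac:(by []))
    witness_delta_le1 witness_delta_eps.

Lemma witness_sdpda_complete j (i : 'I_n.+1) : i + j <= n ->
  accepts witness_sdpda [:: i] (nseq j false ++ [:: true]).
Proof.
elim: j i => [|j IH] i hij.
  apply: steps_step (rt1n_refl _ _ _).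
  by apply: (@Step _ _ witness_sdpda [::] [::] i (Some true)); rewrite in_fset1.
have hi : i < n by apply: leq_trans hij; rewrite -addSnnS leq_addr.
have h : accepts witness_sdpda [:: inord i.+1] (nseq j false ++ [:: true]).
  by apply: IH; rewrite inordK // addSnnS.
apply: steps_step h.
apply: (@Step _ _ witness_sdpda [::] [:: inord i.+1] i (Some false)).
by rewrite /= hi in_fset1.
Qed.

(** The bound [n - i] makes the induction on [w] work: each [false] raises the counter and lowers
    the remaining allowance by one. *)
Lemma witness_sdpda_sound w (i : 'I_n.+1) :
  accepts witness_sdpda [:: i] w -> witness (n - i) w.
Proof.
elim: w i => [|b w IH] i h; inversion h as [|c c' s ss e]; subst;
  inversion s as [g x A a sigma hx [eg es] ec];
  move: eg; rewrite -[[:: i]]/(rcons [::] i) => /rcons_inj [? ?]; subst g A.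
  by case: a hx es.
case: a hx es => [a|//] /= hx [? ?]; subst a sigma c.
case: b hx {h s} => /= hx.
  move: hx ss; rewrite in_fset1 => /eqP -> /(@accepts_nil _ _ _ w) ->.
  by exists 0.
move: hx; case: ifP => // hi; rewrite in_fset1 => /eqP ex; rewrite ex in ss.
have [j hj ->] := IH _ ss.
exists j.+1 => //; apply: leq_ltn_trans hj _.
by rewrite inordK // ltn_sub2l.
Qed.

Lemma witness_upper_bound : SDPDA n.+1 (witness n).
Proof.
exists 'I_n.+1, witness_sdpda; split; first by rewrite card_ord.
move=> w; rewrite acceptedE; split.
  by case=> j hj ->; apply: witness_sdpda_complete.
by move/witness_sdpda_sound; rewrite subn0.
Qed.

End WitnessAutomaton.

Theorem theorem2 (n : nat) (hn : 1 <= n) :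
  proper_subfamily (SDPDA n) (SDPDA n.+1) /\
  exists (Sigma : finType) (L : language Sigma),
    #|Sigma| = 2 /\ SDPDA n.+1 L /\ ~ SDPDA n L.
Proof.
split; last first.
  exists bool, (witness n); rewrite card_bool; do 2!split => //.
    exact: witness_upper_bound.
  exact: witness_lower_bound.
split.
  move=> Sigma L [Gamma [M [card_Gamma hM]]].
  by exists Gamma, M; split => //; apply: leqW.
move=> sub; exact: witness_lower_bound (sub _ _ (witness_upper_bound n)).
Qed.
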